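(* Let $\Delta t>0$ be arbitrary, and let $V_h$, $A(\cdot,\cdot)$, $\Phi$, $B$, $b(\cdot)$, $D_t$ and the initial data $u_h^0, r^0$ be as in the context. Set $E^n := E(u_h^n,q_h^n,r^n)=\frac12\int_\Omega (q_h^n)^2\,dx+(r^n)^2$. (i) Consider the first order SAV-DG scheme: for $n\ge 0$ find $(u_h^n,q_h^n)\in V_h\times V_h$ and $r^n\in\mathbb{R}$ such that for all $\phi,\psi\in V_h$, $$(D_t u_h^n,\phi)=-A(q_h^{n+1},\phi)-r^{n+1}(b(u_h^n),\phi),\qquad (q_h^n,\psi)=A(u_h^n,\psi),\qquad D_t r^n=\frac12\int_\Omega b(u_h^n)\,D_tu_h^n\,dx,$$ where the second equation is imposed at every time level $n\ge 0$. This scheme admits a unique solution $(u_h^n,q_h^n)$ (together with $r^n$), and for every $n\ge0$ $$E^{n+1}=E^n-\frac{\|u_h^{n+1}-u_h^n\|^2}{\Delta t}-\frac12\|q_h^{n+1}-q_h^n\|^2-|r^{n+1}-r^n|^2 .$$ (ii) Consider the second order SAV-DG scheme: for $n\ge 0$ find $(u_h^n,q_h^n)\in V_h\times V_h$ and $r^n\in\mathbb{R}$ such that for all $\phi,\psi\in V_h$, $$(D_t u_h^n,\phi)=-A(q_h^{n+1/2},\phi)-r^{n+1/2}(b(u_h^{n,*}),\phi),\qquad (q_h^n,\psi)=A(u_h^n,\psi),\qquad D_t r^n=\frac12\int_\Omega b(u_h^{n,*})\,D_tu_h^n\,dx,$$ where the second equation is imposed at every time level $n\ge 0$, $v^{n+1/2}=(v^n+v^{n+1})/2$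 for $v=q_h,r$, and $u_h^{n,*}=\frac32u_h^n-\frac12u_h^{n-1}$ with $u_h^{-1}:=u_h^0$. This scheme admits a unique solution, and for every $n\ge0$ $$E^{n+1}=E^n-\frac{\|u_h^{n+1}-u_h^n\|^2}{\Delta t}.$$
   Context: $\Omega\subset\mathbb{R}^d$ is a convex bounded domain, partitioned by a shape regular mesh $\mathcal{T}_h=\{K\}$; $k$ is a fixed polynomial degree and $V_h=\{v\in L^2(\Omega): v|_K\in P^k(K)\ \forall K\in\mathcal{T}_h\}$, where $P^k(K)$ is the set of polynomials of degree at most $k$ on $K$. $(\cdot,\cdot)$ and $\|\cdot\|$ are the $L^2(\Omega)$ inner product and norm. $\Gamma^0$ is the set of interior interfaces and $\Gamma^\partial$ the set of boundary faces. On an interface $e\subset\partial K_1\cap\partial K_2$ with unit normal $\nu$ oriented from $K_1$ to $K_2$, $\{v\}=\frac12(v|_{\partial K_1}+v|_{\partial K_2})$ and $[v]=v|_{\partial K_2}-v|_{\partial K_1}$, where $v|_{\partial K_i}$ is the trace on $e$ taken from $K_i$. With a real parameter $a$, the bilinear form on $V_h\times V_h$ is $A(w,v)=A^0(w,v)+A^b(w,v)$, $$A^0(w,v)=\sum_{K\in\mathcal{T}_h}\int_K\left(\nabla w\cdot\nabla v-\frac a2wv\right)dx+\sum_{e\in\Gamma^0}\int_e\left(\{\partial_\nu w\}[v]+[w]\{\partial_\nu v\}\right)ds .$$ One of two boundary conditions is fixed: (periodic case) $A^b(w,v)=\frac12\int_{\Gamma^\partial}(\{\partial_\nu w\}[v]+[w]\{\partial_\nu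 v\})\,ds$, where opposite boundary faces are identified so that each such face has two neighbouring elements (the factor $\frac12$ avoids double counting); or (case $\partial_{\mathbf n}u=\partial_{\mathbf n}\Delta u=0$ on $\partial\Omega$) $A^b(w,v)=0$. This is a DG discretization for $u_t=-(\Delta+\frac a2)^2u-\Phi'(u)$. $\Phi:\mathbb{R}\to\mathbb{R}$ is a (nonlinear) continuously differentiable function, and $B$ is a constant such that $\int_\Omega\Phi(v(x))\,dx+B>0$ for all functions $v$ considered (elements of $V_h$ and the initial datum $u_0$). For such $w$, $$b(w)=\frac{\Phi'(w)}{\sqrt{\int_\Omega\Phi(w(x))\,dx+B}} .$$ $\Pi$ is the $L^2$ projection onto $V_h$. Initial data: $u_h^0=\Pi u_0$, $r^0=\sqrt{\int_\Omega\Phi(u_0(x))\,dx+B}$. $D_tv^n=\frac{v^{n+1}-v^n}{\Delta t}$. *)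

(* Defs.v *)
From HB Require Import structures.
From mathcomp Require Import all_boot all_order all_algebra.
From mathcomp Require Import all_classical all_reals all_analysis.
Set Implicit Arguments.
Unset Strict Implicit.
Unset Printing Implicit Defensive.
Import Order.TTheory GRing.Theory Num.Theory numFieldNormedType.Exports.
Local Open Scope classical_set_scope.
Local Open Scope ring_scope.

(* The Borel sigma-algebra of R^n, generated by the coordinates. *)
Definition measure_rV_display : measure_display.
Proof. exact: default_measure_display. Qed.

Lemma g_sigma_preimage_coord d (rT : semiRingOfSetsType d) (aT : Type) n
    (f : 'I_n -> aT -> rT) i (A : set rT) :
  measurable A -> g_sigma_preimage f (f i @^-1` A).
Proof.
case: n f i => [? [] []//|n] f i mA; apply: sub_sigma_algebra.
rewrite -bigcup_mkord_ord; exists i; first exact: ltn_ord.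
by exists A; rewrite ?inord_val ?setTI.
Qed.

Section measurable_rV.
Variables (R : realType) (n : nat).

Let coord : 'I_n -> 'rV[R]_n -> R := fun i x => x 0 i.

Let rV_set0 : g_sigma_preimage coord set0.
Proof. exact: sigma_algebra0. Qed.

Let rV_setC A : g_sigma_preimage coord A -> g_sigma_preimage coord (~` A).
Proof. exact: sigma_algebraC. Qed.

Let rV_bigcup (F : (set 'rV[R]_n)^nat) :
  (forall i, g_sigma_preimage coord (F i)) ->
  g_sigma_preimage coord (\bigcup_i (F i)).
Proof. exact: sigma_algebra_bigcup. Qed.

HB.instance Definition _ := @isMeasurable.Build measure_rV_display
  'rV[R]_n (g_sigma_preimage coord) rV_set0 rV_setC rV_bigcup.

Lemma measurable_coord (i : 'I_n) :
  measurable_fun [set: 'rV[R]_n] (fun x : 'rV[R]_n => x 0 i).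
Proof.
by move=> _ A mA; rewrite setTI; exact: g_sigma_preimage_coord.
Qed.

Lemma measurable_fun_rV d (T : measurableType d) (f : T -> 'rV[R]_n) :
  (forall i, measurable_fun [set: T] (fun x => f x 0 i)) ->
  measurable_fun [set: T] f.
Proof.
move=> mf.
suff H : g_sigma_preimage (fun i x => f x 0 i) `<=` (@measurable _ T).
  rewrite (_ : (fun i x => f x 0 i) = (fun i => coord i \o f)) // in H.
  rewrite g_sigma_preimage_comp in H.
  by move=> _ A mA; apply: H; exists A.
apply: smallest_sub; first exact: sigma_algebra_measurable.
case: n f mf => [|m] f mf; first by rewrite big_ord0.
rewrite -bigcup_mkord_ord; apply: bigcup_sub => i Ii.
by move=> A [B mB <-]; exact: mf.
Qed.

End measurable_rV.

Section lebesgue_rV_step.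
Variables (R : realType) (n : nat).
Variable m : {sigma_finite_measure set 'rV[R]_n -> \bar R}.

Definition consrV (p : measurableTypeR R * 'rV[R]_n) : 'rV[R]_n.+1 :=
  row_mx (p.1%:M : 'M[R]_1) p.2.

Definition unconsrV (x : 'rV[R]_n.+1) : measurableTypeR R * 'rV[R]_n :=
  (x 0 0, rsubmx (x : 'rV_(1 + n))).

Lemma consrV_head p (i : 'I_1) : consrV p 0 (@lshift 1 n i) = p.1.
Proof.
by apply: (etrans (row_mxEl _ _ _ _)); rewrite (ord1 i) mxE eqxx mulr1n.
Qed.

Lemma consrV_tail p (i : 'I_n) : consrV p 0 (@rshift 1 n i) = p.2 0 i.
Proof. exact: row_mxEr. Qed.

Lemma consrVK : cancel consrV unconsrV.
Proof.
move=> p; rewrite /unconsrV [p in RHS]surjective_pairing; congr (_, _).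
  by rewrite -[RHS](consrV_head p ord0); congr (_ _ _); exact/val_inj.
exact: row_mxKr.
Qed.

Lemma measurable_consrV : measurable_fun setT consrV.
Proof.
apply: measurable_fun_rV => i.
case: (split_ordP (i : 'I_(1 + n))) => j ->.
  by rewrite (_ : (fun _ => _) = fst) //; apply/funext => p; exact: consrV_head.
rewrite (_ : (fun _ => _) = (fun x : 'rV[R]_n => x 0 j) \o snd); last first.
  by apply/funext => p; exact: consrV_tail.
by apply: measurableT_comp => //; exact: measurable_coord.
Qed.

Lemma measurable_unconsrV : measurable_fun setT unconsrV.
Proof.
apply: measurable_fun_pair => /=; first exact: measurable_coord.
apply: measurable_fun_rV => i.
rewrite (_ : (fun _ => _) = fun x : 'rV[R]_n.+1 => x 0 (@rshift 1 n i)).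
  exact: measurable_coord.
by apply/funext => x; rewrite mxE.
Qed.

Definition lebesgue_rVS : set 'rV[R]_n.+1 -> \bar R :=
  pushforward (@lebesgue_measure R \x m)%E consrV.


Let lebesgue_rVS0 : lebesgue_rVS set0 = 0%E.
Proof. by rewrite /lebesgue_rVS /pushforward preimage_set0 measure0. Qed.

Let lebesgue_rVS_ge0 A : (0 <= lebesgue_rVS A)%E.
Proof. exact: (measure_ge0 (@lebesgue_measure R \x m)%E). Qed.

Let lebesgue_rVS_sigma_additive : semi_sigma_additive lebesgue_rVS.
Proof.
exact: (@measure_semi_sigma_additive _ _ _
  (measure_function_pushforward__canonical__measure_function_Measure
     (@lebesgue_measure R \x m)%E measurable_consrV)).
Qed.

HB.instance Definition _ := isMeasure.Build _ _ _ lebesgue_rVS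
  lebesgue_rVS0 lebesgue_rVS_ge0 lebesgue_rVS_sigma_additive.

Let lebesgue_rVS_sigma_finite : sigma_finite setT lebesgue_rVS.
Proof.
have /sigma_finiteP[F [TF ndF Foo]] := sigma_finiteT (@lebesgue_measure R).
have /sigma_finiteP[G [TG ndG Goo]] := sigma_finiteT m.
exists (fun k => unconsrV @^-1` (F k `*` G k)).
  rewrite -preimage_bigcup (_ : \bigcup_k _ = setT) ?preimage_setT //.
  rewrite -subTset => -[x y] _.
  have [i _ Fix] : (\bigcup_k F k) x by rewrite -TF.
  have [j _ Gjy] : (\bigcup_k G k) y by rewrite -TG.
  exists (maxn i j) => //; split.
    by move: x Fix; exact/subsetPset/ndF/leq_maxl.
  by move: y Gjy; exact/subsetPset/ndG/leq_maxr.
move=> k; have [mF Fk] := Foo k; have [mG Gk] := Goo k; split.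
  rewrite -[X in measurable X]setTI.
  by apply: measurable_unconsrV => //; exact: measurableX.
rewrite /lebesgue_rVS /pushforward -comp_preimage.
rewrite (_ : unconsrV \o consrV = id); last by apply/funext; exact: consrVK.
by rewrite preimage_id product_measure1E// lte_mul_pinfty// ge0_fin_numE.
Qed.

HB.instance Definition _ := Measure_isSigmaFinite.Build _ _ _ lebesgue_rVS
  lebesgue_rVS_sigma_finite.
End lebesgue_rV_step.

(* Lebesgue measure on R^n (unit mass at the only point when n = 0). *)
Fixpoint lebesgue_rV (R : realType) (n : nat) :
    {sigma_finite_measure set 'rV[R]_n -> \bar R} :=
  if n is n'.+1 then lebesgue_rVS (lebesgue_rV R n')
  else \d_(0 : 'rV[R]_0).

(* mpoly's notations clash with those of mathcomp-analysis; its structures and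
   functions (mpoly, mderiv, meval, msize) are imported without them. *)
From mathcomp.multinomials Require mpoly.
Export -(notations) mpoly.

Section euclidean.
Variables (R : realType) (n : nat).
Implicit Types (x y : 'rV[R]_n).

Definition dot x y : R := \sum_(i < n) x 0 i * y 0 i.
Definition enorm x : R := Num.sqrt (dot x x).

End euclidean.

(* All faces are pieces of hyperplanes of R^(d+1). Such a piece F is given by an
   isometric chart y |-> origin + y *m frame from an open subset dom of R^d, and
   \int_F f ds is the integral over dom of f composed with the chart; it does
   not depend on the chart. For d = 0 the piece is a point, of mass 1.
   left (K_1) and right (K_2) are the neighbouring elements, the normal points
   from left to right. The trace from the right at x in F is taken at the point
   x + shift of the closure of K_2: shift = 0 for interior interfaces, and it is
   the translation to the opposite face for identified boundary faces. *)
Record face (R : realType) (d : nat) (I : Type) := Face {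
  fdom : set 'rV[R]_d;
  forigin : 'rV[R]_d.+1;
  fframe : 'M[R]_(d, d.+1);
  fnormal : 'rV[R]_d.+1;
  fleft : I;
  fright : I;
  fshift : 'rV[R]_d.+1
}.

Section faces.
Variables (R : realType) (d : nat) (I : Type).
Implicit Types (e : face R d I) (elem : I -> set 'rV[R]_d.+1).

Definition fchart e (y : 'rV[R]_d) : 'rV[R]_d.+1 := forigin e + y *m fframe e.

Definition fset_of e : set 'rV[R]_d.+1 := fchart e @` fdom e.

Definition face_int e (f : 'rV[R]_d.+1 -> R) : R :=
  \int[lebesgue_rV R d]_(y in fdom e) f (fchart e y).

Definition is_face elem e : Prop :=
  [/\ open (fdom e), fdom e !=set0,
      fframe e *m (fframe e)^T = 1%:M,
      fframe e *m (fnormal e)^T = 0 /\ enorm (fnormal e) = 1 &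
      forall x, fset_of e x -> \forall t \near (0 : R)^'+,
        elem (fleft e) (x - t *: fnormal e) /\
        elem (fright e) (x + fshift e + t *: fnormal e)].

End faces.

(* Elements and interfaces are (relatively) open: the partition is understood up
   to the closed skeleton. The interfaces exhaust the skeleton inside Omega. *)
Record mesh (R : realType) (d : nat) (Omega : set 'rV[R]_d.+1) := Mesh {
  cell : finType;
  elem : cell -> set 'rV[R]_d.+1;
  iface : finType;
  ifc : iface -> face R d cell;
  shape_cst : R;
  elem_open : forall K, open (elem K);
  elem_connected : forall K, connected (elem K);
  elem_sub : forall K, elem K `<=` Omega;
  elem_disjoint : forall K L, K != L -> elem K `&` elem L = set0;
  elem_cover : Omega `<=` \bigcup_(K in [set: cell]) closure (elem K);
  (* each element contains a ball of radius r >= diam K / shape_cst *)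
  elem_shape_regular : forall K, exists x r,
    [/\ 0 < r, [set y | enorm (y - x) < r] `<=` elem K &
        forall y z, elem K y -> elem K z -> enorm (y - z) <= shape_cst * r];
  ifc_face : forall e, is_face elem (ifc e);
  ifc_shift : forall e, fshift (ifc e) = 0;
  ifc_neq : forall e, fleft (ifc e) != fright (ifc e);
  ifc_sub : forall e, fset_of (ifc e) `<=` Omega;
  ifc_disjoint : forall e e', e != e' ->
    fset_of (ifc e) `&` fset_of (ifc e') = set0;
  ifc_cover : forall K, Omega `&` (closure (elem K) `\` elem K) `<=`
    \bigcup_(e in [set: iface]) closure (fset_of (ifc e))
}.

Arguments elem {R d Omega} m K _.

(* Identification of opposite boundary faces: the rows of period span the period
   lattice, whose nonzero translates of Omega do not meet Omega; bopp exchanges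
   the two faces of a pair, which differ by a lattice vector and have opposite
   outward normals. *)
Record periodic_bdry (R : realType) (d : nat) (Omega : set 'rV[R]_d.+1)
    (T : mesh Omega) := PeriodicBdry {
  period : 'M[R]_d.+1;
  bface : finType;
  bfc : bface -> face R d (cell T);
  bopp : bface -> bface;
  period_unit : period \in unitmx;
  period_tile : forall z : 'rV[int]_d.+1, z != 0 ->
    Omega `&` [set x + map_mx intr z *m period | x in Omega] = set0;
  bfc_face : forall e, is_face (elem T) (bfc e);
  bfc_sub : forall e, fset_of (bfc e) `<=` closure Omega `\` Omega;
  bfc_disjoint : forall e e', e != e' ->
    fset_of (bfc e) `&` fset_of (bfc e') = set0;
  bfc_cover : closure Omega `\` Omega `<=`
    \bigcup_(e in [set: bface]) closure (fset_of (bfc e));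
  bfc_shift : forall e, exists z : 'rV[int]_d.+1,
    fshift (bfc e) = map_mx intr z *m period;
  boppK : involutive bopp;
  bopp_set : forall e,
    fset_of (bfc (bopp e)) = [set x + fshift (bfc e) | x in fset_of (bfc e)];
  bopp_shift : forall e, fshift (bfc (bopp e)) = - fshift (bfc e);
  bopp_normal : forall e, fnormal (bfc (bopp e)) = - fnormal (bfc e);
  bopp_left : forall e, fleft (bfc (bopp e)) = fright (bfc e);
  bopp_right : forall e, fright (bfc (bopp e)) = fleft (bfc e)
}.

(* Neumann: the normal derivatives of u and of its Laplacian vanish on the
   boundary. *)
Variant bdry_cond (R : realType) (d : nat) (Omega : set 'rV[R]_d.+1)
    (T : mesh Omega) :=
  | Periodic of periodic_bdry T
  | Neumann.
Arguments Neumann {R d Omega T}.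

Section dg.
Variables (R : realType) (d : nat) (Omega : set 'rV[R]_d.+1).
Variables (T : mesh Omega) (bc : bdry_cond T) (k : nat) (a : R).

(* A broken polynomial is the family of its restrictions to the elements; an
   L^2 class of V_h determines this family, as elements are open and nonempty.
   msize is the total degree plus one, 0 for the null polynomial. *)
Definition broken := {ffun cell T -> mpoly d.+1 R}.
Implicit Types (w v : broken) (e : face R d (cell T)).

Definition Vh v : Prop := forall K, (msize (v K) <= k.+1)%N.

Definition peval (p : mpoly d.+1 R) (x : 'rV[R]_d.+1) : R :=
  meval (fun i => x 0 i) p.

Definition pgrad (p : mpoly d.+1 R) (x : 'rV[R]_d.+1) : 'rV[R]_d.+1 :=
  \row_i peval (mderiv i p) x.

(* The function on Omega, set to 0 on the skeleton. *)
Definition dgfun v (x : 'rV[R]_d.+1) : R :=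
  \sum_(K : cell T) \1_(elem T K) x * peval (v K) x.

Definition inner (f g : 'rV[R]_d.+1 -> R) : R :=
  \int[lebesgue_rV R d.+1]_(x in Omega) (f x * g x).

Definition L2norm (f : 'rV[R]_d.+1 -> R) : R := Num.sqrt (inner f f).

Definition jump e v (x : 'rV[R]_d.+1) : R :=
  peval (v (fright e)) (x + fshift e) - peval (v (fleft e)) x.

Definition avg_dn e v (x : 'rV[R]_d.+1) : R :=
  (dot (pgrad (v (fleft e)) x) (fnormal e) +
   dot (pgrad (v (fright e)) (x + fshift e)) (fnormal e)) / 2.

Definition face_form w v e : R :=
  face_int e (fun x => avg_dn e w x * jump e v x + jump e w x * avg_dn e v x).

Definition A0 w v : R :=
  \sum_(K : cell T) \int[lebesgue_rV R d.+1]_(x in elem T K)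
     (dot (pgrad (w K) x) (pgrad (v K) x)
      - a / 2 * (peval (w K) x * peval (v K) x))
  + \sum_(e : iface T) face_form w v (ifc e).

Definition Ab w v : R :=
  match bc with
  | Periodic P => 2^-1 * \sum_(e : bface P) face_form w v (bfc e)
  | Neumann => 0
  end.

Definition Aform w v : R := A0 w v + Ab w v.

Definition is_L2proj (f : 'rV[R]_d.+1 -> R) v : Prop :=
  Vh v /\ forall phi, Vh phi -> inner (dgfun v) (dgfun phi) = inner f (dgfun phi).

Variables (Phi : R -> R) (B : R).

Definition potential (f : 'rV[R]_d.+1 -> R) : R :=
  \int[lebesgue_rV R d.+1]_(x in Omega) Phi (f x) + B.

Definition bSAV (f : 'rV[R]_d.+1 -> R) (x : 'rV[R]_d.+1) : R :=
  derive1 Phi (f x) / Num.sqrt (potential f).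

Definition energy (q : broken) (r : R) : R :=
  2^-1 * \int[lebesgue_rV R d.+1]_(x in Omega) (dgfun q x ^+ 2) + r ^+ 2.

Variables (u0 : 'rV[R]_d.+1 -> R) (dt : R).

Record sol := Sol { su : nat -> broken; sq : nat -> broken; sr : nat -> R }.

Definition Dt (v : nat -> broken) (n : nat) : broken :=
  dt^-1 *: (v n.+1 - v n).

Definition Dtr (r : nat -> R) (n : nat) : R := (r n.+1 - r n) / dt.

Definition initial (s : sol) : Prop :=
  is_L2proj u0 (su s 0) /\ sr s 0 = Num.sqrt (potential u0).

Definition constitutive (s : sol) : Prop :=
  forall n psi, Vh psi -> inner (dgfun (sq s n)) (dgfun psi) = Aform (su s n) psi.

Definition first_order_sav (s : sol) : Prop :=
  [/\ forall n, Vh (su s n) /\ Vh (sq s n),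
      initial s,
      forall n phi, Vh phi ->
        inner (dgfun (Dt (su s) n)) (dgfun phi) =
        - Aform (sq s n.+1) phi
        - sr s n.+1 * inner (bSAV (dgfun (su s n))) (dgfun phi),
      constitutive s &
      forall n, Dtr (sr s) n =
        2^-1 * \int[lebesgue_rV R d.+1]_(x in Omega)
          (bSAV (dgfun (su s n)) x * dgfun (Dt (su s) n) x)].

(* For n = 0, u^(-1) := u^0 since 0.-1 = 0. *)
Definition ustar (u : nat -> broken) (n : nat) : broken :=
  (3 / 2) *: u n - 2^-1 *: u n.-1.

Definition second_order_sav (s : sol) : Prop :=
  [/\ forall n, Vh (su s n) /\ Vh (sq s n),
      initial s,
      forall n phi, Vh phi ->
        inner (dgfun (Dt (su s) n)) (dgfun phi) =
        - Aform (2^-1 *: (sq s n + sq s n.+1)) phi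
        - (sr s n + sr s n.+1) / 2 *
          inner (bSAV (dgfun (ustar (su s) n))) (dgfun phi),
      constitutive s &
      forall n, Dtr (sr s) n =
        2^-1 * \int[lebesgue_rV R d.+1]_(x in Omega)
          (bSAV (dgfun (ustar (su s) n)) x * dgfun (Dt (su s) n) x)].

Definition energy_at (s : sol) (n : nat) : R := energy (sq s n) (sr s n).

End dg.

(* Main.v *)
(* On the finite-dimensional space V_h the form A is symmetric, hence
   represented by a self-adjoint operator L for the L^2 product, and q^n = L u^n.
   Eliminating q^(n+1) and r^(n+1) from a step leaves for u^(n+1) a linear
   problem whose form dominates the L^2 product, hence is positive definite; this
   gives existence and uniqueness step by step. The energy law follows by testing
   the evolution equation with u^(n+1) - u^n and the increment of the
   constitutive equation with the averaged q. The two schemes are the cases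
   theta = 1 and theta = 1/2 of the average (1 - theta) x^n + theta x^(n+1).
   The L^2 product is definite on broken polynomials because a polynomial
   vanishing on a cube is null. *)

Require Import Defs.
From mathcomp Require Import all_boot all_order all_algebra.
From mathcomp Require Import all_classical all_reals all_analysis.
From mathcomp Require Import measurable_realfun ring lra.
Set Implicit Arguments.
Unset Strict Implicit.
Unset Printing Implicit Defensive.
Import Order.TTheory GRing.Theory Num.Theory numFieldNormedType.Exports.
Local Open Scope classical_set_scope.
Local Open Scope ring_scope.

(** * Averaged SAV steps on a finite-dimensional space *)

Section scalar_functionals.
Variables (R : nzRingType) (V : lmodType R) (f : V -> R).
Hypothesis f_lin : scalar f.

Lemma scalar_additive : {morph f : x y / x - y}.
Proof. by move=> x y; rewrite addrC -scaleN1r f_lin mulN1r addrC. Qed.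

Lemma scalar0 : f 0 = 0.
Proof. by rewrite -(subrr 0) scalar_additive subrr. Qed.

Lemma scalarZ a x : f (a *: x) = a * f x.
Proof. by rewrite -[a *: x]addr0 f_lin scalar0 addr0. Qed.

Lemma scalarD : {morph f : x y / x + y}.
Proof. by move=> x y; rewrite -{1}[x]scale1r f_lin mul1r. Qed.

Lemma scalar_sum I (r : seq I) (F : I -> V) :
  f (\sum_(i <- r) F i) = \sum_(i <- r) f (F i).
Proof. exact: (big_morph f scalarD scalar0). Qed.

End scalar_functionals.

(** * Variational problems with a positive definite form on a finite span *)

Section posdef_solve.
Variables (R : realFieldType) (V : lmodType R) (S : V -> Prop).
Variables (N : nat) (b : 'I_N -> V).
Hypothesis S_span : forall v, S v <-> exists c : 'I_N -> R, v = \sum_i c i *: b i.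
Hypothesis b_free : forall c : 'I_N -> R,
  \sum_i c i *: b i = 0 -> forall i, c i = 0.

Lemma span_linear t u v : S u -> S v -> S (t *: u + v).
Proof.
move=> /S_span[c ->] /S_span[c' ->]; apply/S_span.
exists (fun i => t * c i + c' i).
rewrite scaler_sumr -big_split /=; apply: eq_bigr => i _.
by rewrite scalerDl scalerA.
Qed.

Lemma spanB u v : S u -> S v -> S (u - v).
Proof. by move=> Su Sv; rewrite addrC -scaleN1r; exact: span_linear. Qed.

(** Lax-Milgram in finite dimension: a row [c] with c G = 0 gives M(e c, e c) = 0, hence c = 0 by
    definiteness and the freeness of [b]. So the Gram matrix [G] is invertible. *)
Lemma posdef_solve (M : V -> V -> R) (f : V -> R) :
  (forall v, scalar (M^~ v)) -> (forall u, scalar (M u)) ->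
  (forall v, S v -> v != 0 -> 0 < M v v) -> scalar f ->
  exists2 w, S w & forall v, S v -> M w v = f v.
Proof.
move=> Ml Mr Mpos flin.
pose G := \matrix_(i, j) M (b i) (b j).
pose e (c : 'rV[R]_N) := \sum_i c 0 i *: b i.
have eS c : S (e c) by apply/S_span; exists (c 0).
have ME c j : M (e c) (b j) = (c *m G) 0 j.
  rewrite mxE (scalar_sum (Ml _)); apply: eq_bigr => i _.
  by rewrite (scalarZ (Ml _)) mxE.
have MeE c c' : M (e c) (e c') = \sum_i c' 0 i * (c *m G) 0 i.
  rewrite {2}/e (scalar_sum (Mr _)); apply: eq_bigr => i _.
  by rewrite (scalarZ (Mr _)) ME.
have Gunit : G \in unitmx.
  rewrite -row_free_unit; apply/row_freeP.
  suff /inj_row_free/row_freeP : forall c : 'rV_N, c *m G = 0 -> c = 0 by [].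
  move=> c cG0; suff /eqP /b_free c0 : e c == 0.
    by apply/rowP => i; rewrite c0 mxE.
  apply: contraT => /(Mpos _ (eS c)).
  by rewrite MeE big1 ?ltxx// => i _; rewrite cG0 mxE mulr0.
exists (e ((\row_j f (b j)) *m invmx G)) => // v /S_span[c ->].
rewrite (scalar_sum (Mr _)) (scalar_sum flin); apply: eq_bigr => i _.
by rewrite (scalarZ (Mr _)) (scalarZ flin) ME mulmxKV// mxE.
Qed.

Lemma posdef_solve_unique (M : V -> V -> R) (w w' : V) :
  (forall v, scalar (M^~ v)) ->
  (forall v, S v -> v != 0 -> 0 < M v v) -> S w -> S w' ->
  (forall v, S v -> M w v = M w' v) -> w = w'.
Proof.
move=> Ml Mpos Sw Sw' Mww'; apply/eqP; rewrite -subr_eq0; apply: contraT.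
move=> /(Mpos _ (spanB Sw Sw')).
by rewrite (scalar_additive (Ml _)) Mww' ?subrr ?ltxx//; exact: spanB.
Qed.

End posdef_solve.

(** * The averaged scheme with weight theta: solvability and energy identity *)

Section sav.
Variables (R : realFieldType) (V : lmodType R) (S : V -> Prop).
Variables (N : nat) (b : 'I_N -> V).
Hypothesis S_span : forall v, S v <-> exists c : 'I_N -> R, v = \sum_i c i *: b i.
Hypothesis b_free : forall c : 'I_N -> R,
  \sum_i c i *: b i = 0 -> forall i, c i = 0.
Variables (ip A : V -> V -> R) (beta : V -> V -> R) (f0 : V -> R) (r0 : R).
Hypothesis ip_lin : forall v, scalar (ip^~ v).
Hypothesis ip_sym : forall u v, ip u v = ip v u.
Hypothesis ip_posdef : forall v, S v -> v != 0 -> 0 < ip v v.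
Hypothesis A_lin : forall v, scalar (A^~ v).
Hypothesis A_sym : forall u v, A u v = A v u.
Hypothesis beta_lin : forall w, scalar (beta w).
Hypothesis f0_lin : scalar f0.
Variables (ext : V -> V -> V) (theta dt : R).
Hypothesis theta_ge0 : 0 <= theta.
Hypothesis dt_gt0 : 0 < dt.

Definition avgV (x y : V) : V := (1 - theta) *: x + theta *: y.
Definition avgR (x y : R) : R := (1 - theta) * x + theta * y.

(** [p] and [u] are the two latest states, [ext p u] is the point where the nonlinearity is frozen,
    and [beta w phi] stands for (b(w), phi). *)
Definition sav_step (p u q : V) (r : R) (u' q' : V) (r' : R) : Prop :=
  [/\ S u' /\ S q',
      forall phi, S phi -> ip (dt^-1 *: (u' - u)) phi =
        - A (avgV q q') phi - avgR r r' * beta (ext p u) phi,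
      forall psi, S psi -> ip q' psi = A u' psi &
      (r' - r) / dt = 2^-1 * beta (ext p u) (dt^-1 *: (u' - u))].

Definition sav_init (u q : V) (r : R) : Prop :=
  [/\ S u /\ S q, forall phi, S phi -> ip u phi = f0 phi,
      forall psi, S psi -> ip q psi = A u psi & r = r0].

(** At n = 0 the truncated predecessor makes [u 0] the earlier state as well, which encodes u^(-1) =
    u^0. *)
Definition sav_seq (u q : nat -> V) (r : nat -> R) : Prop :=
  sav_init (u 0%N) (q 0%N) (r 0%N) /\
  forall n, sav_step (u n.-1) (u n) (q n) (r n) (u n.+1) (q n.+1) (r n.+1).

Let ip_linr u : scalar (ip u).
Proof. by move=> t x y; rewrite ip_sym ip_lin !(ip_sym u). Qed.

Let A_linr u : scalar (A u).
Proof. by move=> t x y; rewrite A_sym A_lin !(A_sym u). Qed.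

Let ip_ge0 v : S v -> 0 <= ip v v.
Proof.
move=> Sv; have [->|/(ip_posdef Sv)/ltW//] := eqVneq v 0.
by rewrite (scalar0 (@ip_linr _)).
Qed.

Lemma ip_riesz f : scalar f -> exists2 w, S w & forall v, S v -> ip w v = f v.
Proof. exact: (posdef_solve S_span). Qed.

Lemma ip_inj w w' : S w -> S w' -> (forall v, S v -> ip w v = ip w' v) -> w = w'.
Proof. exact: (posdef_solve_unique S_span). Qed.

(** [L u] is the Riesz representative of A(u, .) for [ip]; the constitutive equation then reads q =
    L u. *)
Lemma A_operator : exists L : V -> V, forall u, S (L u) /\
  forall v, S v -> ip (L u) v = A u v.
Proof.
have /choice[L LP] : forall u, exists w, S w /\ forall v, S v -> ip w v = A u v.
  by move=> u; have [w Sw wP] := ip_riesz (@A_linr u); exists w.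
by exists L.
Qed.

(* The form left for u' after elimination of q' and r' is
   (u, v) + dt theta (L u, L v) + (dt theta / 2) b(u) b(v). *)
Lemma sav_step_exists_unique p u q r : exists t : V * V * R,
  sav_step p u q r t.1.1 t.1.2 t.2 /\
  forall u' q' r', sav_step p u q r u' q' r' -> t = (u', q', r').
Proof.
have [L LP] := A_operator; have SL v : S (L v) by have [] := LP v.
have LE v w : S w -> ip (L v) w = A v w by have [_] := LP v; exact.
have L_lin t v w : L (t *: v + w) = t *: L v + L w.
  apply: ip_inj => // [|x Sx]; first exact: (span_linear S_span).
  by rewrite ip_lin !LE// A_lin.
pose be := beta (ext p u); have be_lin : scalar be by exact: beta_lin.
pose c := dt * theta.
have c_ge0 : 0 <= c by rewrite mulr_ge0// ltW.
pose M v w := ip v w + c * ip (L v) (L w) + c / 2 * (be v * be w).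
(* The scalar equation gives r' = r + (be u' - be u) / 2, so the part of the averaged r that is
   known beforehand is r - theta be(u) / 2. *)
pose F w := ip u w - dt * (1 - theta) * A q w
            - dt * (r - theta * (be u / 2)) * be w.
have M_lin v : scalar (M^~ v).
  move=> t x y; rewrite /M ip_lin L_lin ip_lin be_lin /=; ring.
have M_sym v w : M v w = M w v.
  by rewrite /M ip_sym (ip_sym (L v)) (mulrC (be v)).
have M_linr v : scalar (M v).
  by move=> t x y; rewrite M_sym M_lin !(M_sym v).
(* The terms added to [ip] are squares, with coefficients that are nonnegative because [c] is. *)
have M_pos v : S v -> v != 0 -> 0 < M v v.
  move=> Sv v0; rewrite /M -addrA ltr_wpDr ?ip_posdef//.
  by rewrite addr_ge0// mulr_ge0 ?ip_ge0 ?divr_ge0// -expr2 sqr_ge0.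
have F_lin : scalar F.
  move=> t x y; rewrite /F ip_linr A_linr be_lin /=; ring.
have dt0 : dt != 0 by rewrite gt_eqF.
(* By symmetry the constitutive relation applies to the test function: A(L v, w) = A(w, L v) = (L w,
   L v). *)
have ALL v w : S w -> A (L v) w = ip (L v) (L w).
  by move=> Sw; rewrite A_sym -LE// ip_sym.
have be_diff v : be (dt^-1 *: (v - u)) = dt^-1 * (be v - be u).
  by rewrite (scalarZ be_lin) (scalar_additive be_lin).
have ip_diff v w : ip (dt^-1 *: (v - u)) w = dt^-1 * (ip v w - ip u w).
  by rewrite (scalarZ (@ip_lin _)) (scalar_additive (@ip_lin _)).
have [u' Su' u'P] := posdef_solve S_span b_free M_lin M_linr M_pos F_lin.
(* Once u' is known, the constitutive and scalar equations give q' and r' explicitly. *)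
exists (u', L u', r + (be u' - be u) / 2); split => /=.
  split=> // [phi Sphi| |].
  - rewrite ip_diff /avgV A_lin (scalarZ (@A_lin _)) ALL//.
    have := u'P _ Sphi; rewrite /M /F /avgR -/be => u'E.
    apply: (mulfI dt0); rewrite mulrA mulfV// mul1r.
    have -> : ip u' phi = ip u phi - dt * (1 - theta) * A q phi
      - dt * (r - theta * (be u / 2)) * be phi
      - (c * ip (L u') (L phi) + c / 2 * (be u' * be phi)).
      by rewrite -u'E; ring.
    by rewrite /c; field.
  - by move=> psi; exact: LE.
  - by rewrite -/be be_diff addrC addKr; field.
move=> v q' r' [[Sv Sq'] vE q'E r'E].
(* Conversely, these two equations force q' and r' in any solution, whose first component then
   solves the same problem for [M]. *)
have q'L : q' = L v by apply: ip_inj => // w Sw; rewrite LE// q'E.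
have r'v : r' = r + (be v - be u) / 2.
  move: r'E; rewrite -/be be_diff => r'E.
  by rewrite -[r'](subrK r) -[r' - r](divfK dt0) r'E; field.
suff -> : u' = v by rewrite q'L r'v.
apply: (posdef_solve_unique S_span M_lin M_pos) => // phi Sphi.
rewrite u'P// /M /F.
have := vE _ Sphi.
rewrite ip_diff /avgV A_lin (scalarZ (@A_lin _)) q'L ALL// -/be r'v => vE'.
have -> : ip v phi = ip u phi + dt * (dt^-1 * (ip v phi - ip u phi)).
  by rewrite mulrA mulfV// mul1r; ring.
by rewrite vE' /avgR /c; field.
Qed.

Lemma sav_init_exists_unique : exists t : V * V,
  sav_init t.1 t.2 r0 /\
  forall u q r, sav_init u q r -> t = (u, q) /\ r = r0.
Proof.
have [u Su uP] := ip_riesz f0_lin.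
have [q Sq qP] := ip_riesz (@A_linr u).
exists (u, q); split=> // u' q' r' [[Su' Sq'] u'P q'P ->]; split=> //.
have -> : u' = u by apply: ip_inj => // v Sv; rewrite u'P// uP.
congr pair; apply: ip_inj => // v Sv; rewrite q'P// qP//.
by congr A; apply: ip_inj => // w Sw; rewrite u'P// uP.
Qed.

Lemma sav_seq_exists : exists u q r, sav_seq u q r.
Proof.
have [[u0 q0] [/= init _]] := sav_init_exists_unique.
have /choice[F FP] : forall s : V * V * V * R, exists t : V * V * R,
    sav_step s.1.1.1 s.1.1.2 s.1.2 s.2 t.1.1 t.1.2 t.2.
  move=> [[[p u] q] r] /=.
  by have [t [tP _]] := sav_step_exists_unique p u q r; exists t.
(* The state also carries the previous u, which the extrapolation may use; it starts as u^0. *)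
pose next s := (s.1.1.2, (F s).1.1, (F s).1.2, (F s).2).
pose st n := iter n next (u0, u0, q0, r0).
exists (fun n => (st n).1.1.2), (fun n => (st n).1.2), (fun n => (st n).2).
by split=> // -[|n]; exact: FP.
Qed.

Lemma sav_seq_unique u q r u' q' r' : sav_seq u q r -> sav_seq u' q' r' ->
  forall n, (u n, q n, r n) = (u' n, q' n, r' n).
Proof.
move=> [ini stp] [ini' stp'].
have H0 : (u 0%N, q 0%N, r 0%N) = (u' 0%N, q' 0%N, r' 0%N).
  have [t [_ tP]] := sav_init_exists_unique.
  have [tE ->] := tP _ _ _ ini; have [tE' ->] := tP _ _ _ ini'.
  by rewrite -tE tE'.
(* The step from n depends on u^(n-1) too, so the induction carries it along. *)
suff H n : u n.-1 = u' n.-1 /\ (u n, q n, r n) = (u' n, q' n, r' n).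
  by move=> n; have [] := H n.
elim: n => [|n [up [un qn rn]]]; first by case: H0 => -> -> ->.
split=> //=; have [t [_ tP]] := sav_step_exists_unique (u n.-1) (u n) (q n) (r n).
rewrite -(tP _ _ _ (stp n)); apply: tP; rewrite up un qn rn; exact: stp'.
Qed.

(** With m = (1 - theta) q + theta q', the identity 2 (q' - q, m) = |q'|^2 - |q|^2 + (2 theta - 1)
    |q' - q|^2 and its analogue for r produce the factor 2 theta - 1. *)
Lemma sav_step_energy p u q r u' q' r' :
  S u -> S q -> (forall psi, S psi -> ip q psi = A u psi) ->
  sav_step p u q r u' q' r' ->
  2^-1 * ip q' q' + r' ^+ 2 = 2^-1 * ip q q + r ^+ 2
    - ip (u' - u) (u' - u) / dt
    - (2 * theta - 1) * (2^-1 * ip (q' - q) (q' - q) + (r' - r) ^+ 2).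
Proof.
move=> Su Sq qP [[Su' Sq'] u'P q'P r'P].
have dt0 : dt != 0 by rewrite gt_eqF.
have := u'P _ (spanB S_span Su' Su).
rewrite (scalarZ (@ip_lin _)); move: r'P.
have := @beta_lin (ext p u); move: (beta _) => be be_lin r'P.
(* By symmetry of A this is the increment of the constitutive equation tested with the average,
   which lies in the span. *)
have -> : A (avgV q q') (u' - u) = ip (q' - q) (avgV q q').
  have Savg : S (avgV q q').
    apply: (span_linear S_span) => //; rewrite -[_ *: _]addr0.
    apply: (span_linear S_span) => //; rewrite -(subrr q).
    exact: (spanB S_span).
  rewrite (scalar_additive (@ip_lin _)) q'P// qP// A_sym.
  by rewrite (scalar_additive (@A_lin _)).
(* The scalar equation turns the nonlinear term into an increment of r. *)
have -> : be (u' - u) = 2 * (r' - r).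
  rewrite -[r' - r](divfK dt0) r'P (scalarZ be_lin).
  by field.
rewrite mulrC => ->.
rewrite /avgV /avgR ip_linr (scalarZ (@ip_linr _)).
rewrite !(scalar_additive (@ip_lin _)) !(scalar_additive (@ip_linr _)).
by rewrite (ip_sym q' q); field.
Qed.

Lemma sav_seq_energy u q r n : sav_seq u q r ->
  2^-1 * ip (q n.+1) (q n.+1) + r n.+1 ^+ 2 = 2^-1 * ip (q n) (q n) + r n ^+ 2
    - ip (u n.+1 - u n) (u n.+1 - u n) / dt
    - (2 * theta - 1) *
      (2^-1 * ip (q n.+1 - q n) (q n.+1 - q n) + (r n.+1 - r n) ^+ 2).
Proof.
move=> [[[Su0 Sq0] _ cst0 _] stp].
have [Su [Sq qP]] : S (u n) /\ S (q n) /\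
    forall psi, S psi -> ip (q n) psi = A (u n) psi.
  by case: n => [//|n]; have [[]] := stp n.
exact: (sav_step_energy Su Sq qP (stp n)).
Qed.

End sav.

(** * Lebesgue measure on R^n and bounded measurable functions *)

Section measure_rV.
Variable R : realType.

Definition cube n (x : 'rV[R]_n) (e : R) : set 'rV[R]_n :=
  [set y | forall i, `|y 0 i - x 0 i| < e].

Lemma cube_ball n (x : 'rV[R]_n) (e : R) : 0 < e -> cube x e = ball x e.
Proof.
move=> e0; apply/seteqP; split => y.
  move=> xy; split => // i j; rewrite (ord1 i).
  by rewrite -ball_normE /= distrC; exact: xy.
by move=> [_ xy] i; have := xy 0 i; rewrite -ball_normE /= distrC.
Qed.

Lemma open_cube n (U : set 'rV[R]_n) x : open U -> U x ->
  exists2 e, 0 < e & cube x e `<=` U.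
Proof.
move=> /[swap] Ux /(_ _ Ux) /nbhs_ballP[e /= e0 eU].
by exists e => //; rewrite cube_ball.
Qed.

Lemma measurable_cube n (x : 'rV[R]_n) e : measurable (cube x e).
Proof.
rewrite (_ : cube x e = \bigcap_(i in [set: 'I_n])
   ((fun y : 'rV[R]_n => y 0 i) @^-1` ball (x 0 i) e)); last first.
  apply/seteqP; split=> y xy i.
    by move=> _; rewrite /= -ball_normE /= distrC; exact: xy.
  by have := xy i I; rewrite /= -ball_normE /= distrC.
apply: fin_bigcap_measurable => // i _.
rewrite -[X in measurable X]setTI; apply: measurable_coord => //.
exact: measurable_ball.
Qed.

(** The sigma-algebra is generated by the coordinates, so an open set is written as a countable
    union: that of the cubes it contains which have a rational centre and a radius 1/(m+1). *)
Lemma open_measurable_rV n (U : set 'rV[R]_n) : open U -> measurable U.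
Proof.
move=> Uo.
pose F (s : 'rV[rat]_n * nat) : set 'rV[R]_n :=
  let c := cube (map_mx ratr s.1) s.2.+1%:R^-1 in
  [set x | c `<=` U /\ c x].
suff -> : U = \bigcup_s F s.
  apply: countable_bigcupT_measurable => [|s]; first exact: countableP.
  have [sU|sU] :=
      pselect (cube (map_mx (ratr : rat -> R) s.1) s.2.+1%:R^-1 `<=` U).
    rewrite (_ : F s = cube (map_mx ratr s.1) s.2.+1%:R^-1).
      exact: measurable_cube.
    by apply/seteqP; split => y // [].
  rewrite (_ : F s = set0); first exact: measurable0.
  by apply/seteqP; split => y // [].
apply/seteqP; split => [x Ux|x [s _ [sU]]]; last exact: sU.
have [e e0 eU] := open_cube Uo Ux.
(* Two radii 1/(k+1) must fit into [e]: one from [x] to the rational centre, one from the centre to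
   a point of the cube. *)
have [k ke] : exists k, k.+1%:R^-1 < e / 2.
  exists (Num.truncn (e / 2)^-1).
  by rewrite invf_plt ?posrE ?divr_gt0// truncnS_gt.
have k0 : 0 < k.+1%:R^-1 :> R by rewrite invr_gt0.
have /choice[q qP] : forall i, exists q : rat, `|x 0 i - ratr q| < k.+1%:R^-1.
  move=> i; have [|q] := @rat_in_itvoo R (x 0 i) (x 0 i + k.+1%:R^-1).
    by rewrite ltrDl.
  rewrite in_itv /= => /andP[q1 q2]; exists q.
  by rewrite ltr_distlC q2 andbT (lt_trans _ q1)// ltrBlDr ltrDl.
exists (\row_i q i, k) => //=; split=> [y yq|i]; last by rewrite !mxE.
apply: eU => i; have := yq i; rewrite !mxE => yqi; have := qP i.
move=> xqi; apply: le_lt_trans (ler_distD (ratr (q i)) _ _) _.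
by rewrite [e]splitr ltrD// (lt_trans _ ke)// distrC.
Qed.

(** Induction on the dimension: through [consrV] the cube is the product of an interval of length 2e
    and a cube of one dimension less; the base case is the unit mass. *)
Lemma lebesgue_rV_cube n (x : 'rV[R]_n) e : 0 < e ->
  lebesgue_rV R n (cube x e) = ((e *+ 2) ^+ n)%:E.
Proof.
move=> e0; elim: n x => [|n IH] x.
  by rewrite /= diracE expr0 mem_set//= => -[].
rewrite /= /lebesgue_rVS /pushforward.
have -> : @consrV R n @^-1` cube x e =
    ball (x 0 0) e `*` cube (\row_i x 0 (@rshift 1 n i) : 'rV_n) e.
  apply/seteqP; split => [p px|p [p1 p2] i].
    split=> [|i].
      rewrite -ball_normE /= distrC; have := px (@lshift 1 n 0).
      by rewrite consrV_head; congr (`|_ - x _ _| < e); exact/val_inj.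
    by have := px (@rshift 1 n i); rewrite consrV_tail mxE.
  case: (split_ordP (i : 'I_(1 + n))) => j ->.
    rewrite consrV_head; move: p1; rewrite -ball_normE /= distrC.
    by congr (`|_ - x _ _| < e); apply/val_inj; rewrite /= (ord1 j).
  by rewrite consrV_tail; have := p2 j; rewrite mxE.
rewrite product_measure1E//=; last exact: measurable_cube.
rewrite -/(lebesgue_rV R n) IH lebesgue_measure_ball ?ltW//.
  by rewrite -EFinM exprS.
exact: measurable_ball.
Qed.

Definition coord_bounded n (A : set 'rV[R]_n) :=
  exists M, forall x, A x -> forall i, `|x 0 i| <= M.

Lemma bounded_set_coord n (A : set 'rV[R]_n) : bounded_set A -> coord_bounded A.
Proof.
move=> /pinfty_ex_gt0[M _ AM]; exists M => x Ax i.
apply: le_trans (AM _ Ax); rewrite /Num.norm /= mx_normrE.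
exact: (le_bigmax _ (fun ij : 'I_1 * 'I_n => `|x ij.1 ij.2|) (0, i)).
Qed.

Lemma coord_boundedS n (A B : set 'rV[R]_n) :
  A `<=` B -> coord_bounded B -> coord_bounded A.
Proof. by move=> AB [M BM]; exists M => x /AB; exact: BM. Qed.

Lemma lebesgue_rV_bounded n (A : set 'rV[R]_n) : measurable A ->
  coord_bounded A -> (lebesgue_rV R n A < +oo)%E.
Proof.
move=> mA [M AM].
have e0 : 0 < `|M| + 1 by rewrite ltr_wpDl.
apply: (@le_lt_trans _ _ (((`|M| + 1) *+ 2) ^+ n)%:E); last exact: ltry.
rewrite -(lebesgue_rV_cube 0 e0); apply: le_measure; rewrite ?inE//.
  exact: measurable_cube.
move=> x Ax i; rewrite mxE subr0 (le_lt_trans (AM _ Ax i))//.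
by rewrite (le_lt_trans (ler_norm _))// ltrDl.
Qed.

End measure_rV.

(** * Bounded measurable functions and their integrals *)

Section bounded_measurable.
Variables (R : realType) (d : measure_display) (T : measurableType d).
Variable D : set T.
Hypothesis mD : measurable D.

(** Unlike integrability, this property is stable under products, so it passes to polynomial
    expressions; on a set of finite measure it yields integrability. *)
Definition bmeas (f : T -> R) : Prop :=
  measurable_fun D f /\ exists M, forall x, D x -> `|f x| <= M.

Lemma bmeas_cst c : bmeas (fun=> c).
Proof. by split; [exact: measurable_cst|exists `|c|]. Qed.

Lemma bmeasD f g : bmeas f -> bmeas g -> bmeas (fun x => f x + g x).
Proof.
move=> [mf [M fM]] [mg [N gN]]; split; first exact: measurable_funD.
by exists (M + N) => x Dx; rewrite (le_trans (ler_normD _ _))// lerD ?fM ?gN.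
Qed.

Lemma bmeasM f g : bmeas f -> bmeas g -> bmeas (fun x => f x * g x).
Proof.
move=> [mf [M fM]] [mg [N gN]]; split; first exact: measurable_funM.
by exists (M * N) => x Dx; rewrite normrM ler_pM ?fM ?gN.
Qed.

Lemma bmeasB f g : bmeas f -> bmeas g -> bmeas (fun x => f x - g x).
Proof.
move=> bf bg; have := bmeasD bf (bmeasM (bmeas_cst (-1)) bg).
by under eq_fun do rewrite mulN1r.
Qed.

Lemma bmeas_sum I (r : seq I) (F : I -> T -> R) :
  (forall i, bmeas (F i)) -> bmeas (fun x => \sum_(i <- r) F i x).
Proof.
move=> bF; elim: r => [|i r IH].
  by under eq_fun do rewrite big_nil; exact: bmeas_cst.
by under eq_fun do rewrite big_cons; exact: bmeasD.
Qed.

Lemma bmeas_prod I (r : seq I) (F : I -> T -> R) :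
  (forall i, bmeas (F i)) -> bmeas (fun x => \prod_(i <- r) F i x).
Proof.
move=> bF; elim: r => [|i r IH].
  by under eq_fun do rewrite big_nil; exact: bmeas_cst.
by under eq_fun do rewrite big_cons; exact: bmeasM.
Qed.

Lemma bmeasX n f : bmeas f -> bmeas (fun x => f x ^+ n).
Proof.
move=> bf; elim: n => [|n IH]; first exact: bmeas_cst.
by under eq_fun do rewrite exprS; exact: bmeasM.
Qed.

Lemma bmeas_indic (A : set T) : measurable A -> bmeas \1_A.
Proof.
move=> mA; split; first exact: measurable_indic.
by exists 1 => x _; rewrite indicE; case: (_ \in _); rewrite /= ?normr1 ?normr0.
Qed.

Lemma bmeas_meval n (p : mpoly n R) (g : T -> 'I_n -> R) :
  (forall i, bmeas (fun x => g x i)) -> bmeas (fun x => meval (g x) p).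
Proof.
move=> bg; under eq_fun do rewrite mevalE.
apply: bmeas_sum => m; apply: bmeasM; first exact: bmeas_cst.
by apply: bmeas_prod => i; exact: bmeasX.
Qed.

(** A bounded [f] maps [D] into a segment, whose image under the continuous [h] is compact, hence
    bounded. *)
Lemma bmeas_comp (h : R -> R) f : continuous h -> bmeas f -> bmeas (h \o f).
Proof.
move=> hc [mf [M fM]]; split.
  by apply: measurableT_comp => //; exact: continuous_measurable_fun.
have : bounded_set (h @` `[- M, M]).
  apply: compact_bounded; apply: continuous_compact; last exact: segment_compact.
  exact: continuous_subspaceT.
move=> /pinfty_ex_gt0[N _ hN]; exists N => x Dx; apply: hN; exists (f x) => //=.
by rewrite in_itv /= -ler_norml; exact: fM.
Qed.

Variable mu : {measure set T -> \bar R}.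

Lemma bmeas_bounded f : bmeas f -> [bounded f x | x in D].
Proof.
move=> [_ [M fM]]; exists M; split=> [|N MN x Dx]; first exact: num_real.
exact: le_trans (fM _ Dx) (ltW MN).
Qed.

Lemma bmeas_integrable f : (mu D < +oo)%E -> bmeas f ->
  mu.-integrable D (EFin \o f).
Proof.
move=> muD bf; apply: measurable_bounded_integrable => //; first by case: bf.
exact: bmeas_bounded.
Qed.

Lemma integrable_bmeasM f g : mu.-integrable D (EFin \o f) -> bmeas g ->
  mu.-integrable D (EFin \o (fun x => f x * g x)).
Proof.
move=> fi bg; have := integrableMl mD fi bg.1 (bmeas_bounded bg).
by under eq_fun do rewrite /= -EFinM.
Qed.

Lemma Rintegral_linear t f g :
  mu.-integrable D (EFin \o f) -> mu.-integrable D (EFin \o g) ->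
  \int[mu]_(x in D) (t * f x + g x) =
  t * \int[mu]_(x in D) f x + \int[mu]_(x in D) g x.
Proof.
move=> fi gi; rewrite RintegralD ?RintegralZl//.
have := integrableZl mD t fi.
by rewrite /comp; under eq_fun do rewrite -EFinM.
Qed.

End bounded_measurable.

(** * Polynomials vanishing on a cube *)

Section mpoly_vanish.
Variable R : realFieldType.

(** A nonzero polynomial has fewer roots than its size, while an interval supplies as many as
    wanted. *)
Lemma poly_vanish_itv (p : {poly R}) (x e : R) : 0 < e ->
  (forall y, `|y - x| < e -> p.[y] = 0) -> p = 0.
Proof.
move=> e0 p0; apply/eqP; apply: contraT => pn0.
(* The denominators start at 2, so all offsets are strictly below [e]; they are pairwise
   distinct. *)
pose s := [seq x + e / i.+2%:R | i <- iota 0 (size p)].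
suff : (size s < size p)%N by rewrite size_map size_iota ltnn.
apply: max_poly_roots => //.
  apply/allP => _ /mapP[i _ ->]; apply/eqP/p0.
  rewrite addrAC subrr add0r gtr0_norm ?divr_gt0//.
  by rewrite ltr_pdivrMr// ltr_pMr// ltr1n.
rewrite map_inj_uniq ?iota_uniq// => i j /addrI /(mulfI (lt0r_neq0 e0)).
by move=> /invr_inj /eqP; rewrite eqr_nat => /eqP[].
Qed.

Lemma lift_ord_max n (j : 'I_n) : lift ord_max j = widen_ord (leqnSn n) j.
Proof. exact/val_inj/lift_max. Qed.

(** [muni] reads [p] as a polynomial in the last variable: the coefficient of [m] in [p] is that of
    the truncated monomial [res m] in the coefficient of degree [m ord_max]. *)
Lemma muni_inj n : injective (@muni n R).
Proof.
suff H (p : mpoly n.+1 R) : muni p = 0 -> p = 0.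
  move=> p q pq; apply/eqP; rewrite -subr_eq0; apply/eqP/H.
  by rewrite muniB pq subrr.
move=> p0; apply/mpolyP => m; rewrite mcoeff0.
pose w := widen_ord (leqnSn n).
pose res (m1 : multinom n.+1) : multinom n := Multinom [tuple m1 (w i) | i < n].
have resE m1 i : res m1 i = m1 (w i) by rewrite multinomE tnth_mktuple.
have : mcoeff (res m) ((muni p)`_(m ord_max)) = 0 by rewrite p0 coef0 mcoeff0.
rewrite muniE coef_sum raddf_sum /= => H.
have [mp|/memN_msupp_eq0//] := boolP (m \in msupp p).
(* A monomial with the same last exponent and the same truncation equals [m], so only [m]
   contributes to the sum. *)
move: H; rewrite (bigD1_seq m) ?msupp_uniq//= big1 ?addr0.
  by rewrite coefZ coefXn eqxx mulr1 mcoeffZ mcoeffX eqxx mulr1.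
move=> m1 m1m; rewrite coefZ coefXn -mulr_natr.
have [em|] := eqVneq (m ord_max) (m1 ord_max); last by rewrite !mulr0 mcoeff0.
rewrite mulr1 mulr1 mcoeffZ mcoeffX; case: eqVneq => [er|]; last by rewrite mulr0.
case/eqP: m1m; apply/mnmP => i.
have [j ->|->//] := unliftP ord_max i.
have -> : lift ord_max j = w j by exact: lift_ord_max.
by rewrite -!resE; congr (fun_of_multinom _ _).
Qed.

Lemma meval_muni n (x : 'I_n.+1 -> R) (p : mpoly n.+1 R) :
  meval x p =
  (map_poly (meval (x \o widen_ord (leqnSn n))) (muni p)).[x ord_max].
Proof.
rewrite muniE mevalE rmorph_sum horner_sum; apply: eq_bigr => m _.
rewrite big_ord_recr /= map_polyZ map_polyXn hornerZ hornerXn /=.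
rewrite mevalZ mevalX -mulrA.
by congr (_ * (_ * _)); apply: eq_bigr => i _; rewrite multinomE tnth_mktuple.
Qed.

(** Induction on the number of variables: for fixed first coordinates, the univariate polynomial in
    the last one vanishes on an interval, hence is zero; so every coefficient of [muni p] vanishes
    on a cube of lower dimension. *)
Lemma mpoly_vanish_cube n (p : mpoly n R) (x : 'I_n -> R) (e : R) : 0 < e ->
  (forall y : 'I_n -> R, (forall i, `|y i - x i| < e) -> meval y p = 0) -> p = 0.
Proof.
move=> e0; elim: n p x => [|n IH] p x p0.
  apply/mpolyP => m; rewrite mcoeff0.
  have mn0 (m1 m2 : multinom 0) : m1 = m2 by apply/mnmP => -[].
  have pE : p = mpolyC 0 (mcoeff m p).
    apply/mpolyP => m1; rewrite mcoeffC (mn0 m1 m).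
    by case: eqP => [|[]]//; rewrite mulr1.
  have : meval x p = 0 by apply: p0 => -[].
  by rewrite {1}pE mevalC => ->.
apply: (@muni_inj n); rewrite muni0; apply/polyP => j; rewrite coef0.
apply: (IH _ (x \o widen_ord (leqnSn n))) => y yx.
rewrite -coef_map /=; apply/eqP.
suff -> : map_poly (meval y) (muni p) = 0 by rewrite coef0.
apply: (poly_vanish_itv e0 (x := x ord_max)) => t tx.
pose z i := if unlift ord_max i is Some k then y k else t.
have := p0 z; rewrite meval_muni.
have -> : z ord_max = t by rewrite /z unlift_none.
have zy : z \o widen_ord (leqnSn n) =1 y.
  move=> i /=; rewrite /z; have -> : widen_ord (leqnSn n) i = lift ord_max i.
    by rewrite lift_ord_max.
  by rewrite liftK.
have -> : map_poly (meval (z \o widen_ord (leqnSn n))) (muni p) =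
    map_poly (meval y) (muni p).
  by apply: eq_map_poly => q; exact: meval_eq.
apply => i; rewrite /z; case: unliftP => [k ->|->//].
have -> : lift ord_max k = widen_ord (leqnSn n) k.
  exact: lift_ord_max.
exact: yx.
Qed.
End mpoly_vanish.

(** * Bilinearity of the discontinuous Galerkin forms *)

Section polynomial_fields.
Variable R : realType.

Lemma peval_lin n t (p q : mpoly n.+1 R) x :
  peval (t *: p + q) x = t * peval p x + peval q x.
Proof. by rewrite /peval mevalD mevalZ. Qed.

Lemma dotl_lin n t (u v w : 'rV[R]_n) :
  dot (t *: u + v) w = t * dot u w + dot v w.
Proof.
rewrite /dot mulr_sumr -big_split /=; apply: eq_bigr => i _.
by rewrite !mxE mulrDl mulrA.
Qed.

Lemma dotC n (u v : 'rV[R]_n) : dot u v = dot v u.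
Proof. by apply: eq_bigr => i _; rewrite mulrC. Qed.

Lemma pgrad_lin n t (p q : mpoly n.+1 R) x :
  pgrad (t *: p + q) x = t *: pgrad p x + pgrad q x.
Proof. by apply/rowP => i; rewrite !mxE linearP /= peval_lin. Qed.

Lemma continuous_peval n (p : mpoly n.+1 R) : continuous (peval p).
Proof.
have cM (f g : 'rV[R]_n.+1 -> R) : continuous f -> continuous g ->
    continuous (fun x => f x * g x).
  by move=> fc gc x; apply: continuousM; [exact: fc|exact: gc].
have cX m (f : 'rV[R]_n.+1 -> R) : continuous f -> continuous (fun x => f x ^+ m).
  move=> fc; elim: m => [|m IH]; first exact: cst_continuous.
  by under eq_fun do rewrite exprS; exact: cM.
rewrite (_ : peval p = fun x => \sum_(m <- msupp p)
  mcoeff m p * \prod_(i < n.+1) x 0 i ^+ fun_of_multinom m i); last first.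
  by apply/funext => x; rewrite /peval mevalE.
elim: (msupp p) => [|m s IH].
  by under eq_fun do rewrite big_nil; exact: cst_continuous.
under eq_fun do rewrite big_cons.
move=> x; apply: (@continuousD _ _ _ (fun x => mcoeff m p * _)); last exact: IH.
apply: (cM (fun=> _)); first exact: cst_continuous.
elim: (index_enum _) => [|i r IHr].
  by under eq_fun do rewrite big_nil; exact: cst_continuous.
under eq_fun do rewrite big_cons.
by apply: cM => //; apply: cX => z; exact: coord_continuous.
Qed.

Lemma peval_neq0_cube n (p : mpoly n.+1 R) x e : p != 0 -> 0 < e ->
  exists2 y, cube x e y & peval p y != 0.
Proof.
move=> p0 e0; apply: contrapT => H; case/eqP: p0.
apply: (mpoly_vanish_cube e0 (x := x 0)) => y yx.
apply: contrapT => /eqP py; apply: H; exists (\row_i y i).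
  by move=> i; rewrite mxE; exact: yx.
rewrite /peval (_ : meval _ p = meval y p)//.
by apply: meval_eq => i; rewrite mxE.
Qed.

Variables (d : measure_display) (T : measurableType d) (D : set T).
Variables (n : nat) (g h : T -> 'rV[R]_n.+1).
Hypothesis bg : forall i, bmeas D (fun y => g y 0 i).
Hypothesis bh : forall i, bmeas D (fun y => h y 0 i).

Lemma bmeas_peval p : bmeas D (fun y => peval p (g y)).
Proof. by apply: bmeas_meval. Qed.

Lemma bmeas_dot : bmeas D (fun y => dot (g y) (h y)).
Proof. by apply: bmeas_sum => // i; exact: bmeasM. Qed.

End polynomial_fields.

Lemma bmeas_pgrad (R : realType) (d : measure_display) (T : measurableType d)
    (D : set T) n (g : T -> 'rV[R]_n.+1) p :
  (forall i, bmeas D (fun y => g y 0 i)) ->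
  forall i, bmeas D (fun y => pgrad p (g y) 0 i).
Proof.
by move=> bg i; under eq_fun do rewrite mxE; exact: bmeas_peval.
Qed.

Lemma bmeas_coord (R : realType) n (D : set 'rV[R]_n) i : measurable D ->
  coord_bounded D -> bmeas D (fun x : 'rV[R]_n => x 0 i).
Proof.
move=> mD [M DM]; split; last by exists M => x Dx; exact: DM.
apply: (measurable_funS measurableT) => //; exact: measurable_coord.
Qed.

(** A point of the closure is within 1 of [A] in every coordinate. Boundary faces lie in the closure
    of Omega. *)
Lemma coord_bounded_closure (R : realType) n (A : set 'rV[R]_n) :
  coord_bounded A -> coord_bounded (closure A).
Proof.
move=> [M AM]; exists (M + 1) => x Ax i.
have [y [Ay]] := Ax _ (nbhsx_ballx x 1 ltr01).
rewrite -cube_ball// => /(_ i) /ltW xy.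
rewrite -[x 0 i](subrK (y 0 i)) (le_trans (ler_normD _ _))// addrC.
by rewrite lerD ?AM// distrC.
Qed.

(** * Integration on a bounded face through its chart *)

Section face_chart.
Variables (R : realType) (d : nat) (I : Type) (e : face R d I).
Hypothesis frame_isometric : fframe e *m (fframe e)^T = 1%:M.
Hypothesis fset_bounded : coord_bounded (fset_of e).
Hypothesis fdom_open : open (fdom e).

(** The frame has orthonormal rows, so y = (chart y - origin) frame^T, and the bound on the face
    passes to the parameter domain. *)
Lemma fdom_bounded : coord_bounded (fdom e).
Proof.
have [M HM] := fset_bounded.
(* Summing over all rows gives one constant valid for every coordinate of y. *)
exists (\sum_i \sum_j (`|M| + `|forigin e 0 j|) * `|fframe e i j|) => y yD i.
have -> : y = (fchart e y - forigin e) *m (fframe e)^T.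
  by rewrite /fchart addrC addKr -mulmxA frame_isometric mulmx1.
rewrite mxE (bigD1 i)//= ler_wpDr//.
  by rewrite sumr_ge0// => ? _; rewrite sumr_ge0// => ? _; rewrite mulr_ge0.
rewrite (le_trans (ler_norm_sum _ _ _))// ler_sum// => j _.
have -> : (fframe e)^T j i = fframe e i j by rewrite mxE.
rewrite normrM ler_wpM2r// mxE [(- forigin e) 0 j]mxE.
rewrite (le_trans (ler_normB _ _))// lerD2r (le_trans _ (ler_norm _))//.
by apply: HM; exists y.
Qed.

Lemma measurable_fdom : measurable (fdom e).
Proof. exact: open_measurable_rV. Qed.

Lemma bmeas_fchart z i : bmeas (fdom e) (fun y => (fchart e y + z) 0 i).
Proof.
have mD := measurable_fdom; rewrite /fchart.
under eq_fun do rewrite !mxE.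
apply: bmeasD => //; last exact: bmeas_cst.
apply: bmeasD => //; first exact: bmeas_cst.
apply: bmeas_sum => // j; apply: bmeasM => //; last exact: bmeas_cst.
by apply: bmeas_coord => //; exact: fdom_bounded.
Qed.

Lemma face_int_linear t f g :
  bmeas (fdom e) (f \o fchart e) -> bmeas (fdom e) (g \o fchart e) ->
  face_int e (fun x => t * f x + g x) = t * face_int e f + face_int e g.
Proof.
move=> bf bg; apply: Rintegral_linear; first exact: measurable_fdom.
- apply: bmeas_integrable => //; first exact: measurable_fdom.
  by apply: lebesgue_rV_bounded; [exact: measurable_fdom|exact: fdom_bounded].
- apply: bmeas_integrable => //; first exact: measurable_fdom.
  by apply: lebesgue_rV_bounded; [exact: measurable_fdom|exact: fdom_bounded].
Qed.

End face_chart.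

(** * The L^2 product and the form A on broken polynomials *)

Section dg_forms.
Variables (R : realType) (d : nat) (Omega : set 'rV[R]_d.+1) (T : mesh Omega).
Hypothesis Omega_open : open Omega.
Hypothesis Omega_bounded : bounded_set Omega.
Implicit Types (u v w : broken T) (e : face R d (cell T)).

Lemma measurable_Omega : measurable Omega.
Proof. exact: open_measurable_rV. Qed.

Lemma measurable_elem K : measurable (elem T K).
Proof. by apply: open_measurable_rV; exact: elem_open. Qed.

Lemma elem_bounded K : coord_bounded (elem T K).
Proof.
apply: coord_boundedS (bounded_set_coord Omega_bounded).
exact: elem_sub.
Qed.

Lemma Omega_finite : (lebesgue_rV R d.+1 Omega < +oo)%E.
Proof.
by apply: lebesgue_rV_bounded; [exact: measurable_Omega|exact: bounded_set_coord].
Qed.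

Lemma bmeas_dgfun v : bmeas Omega (dgfun v).
Proof.
apply: bmeas_sum => K; apply: bmeasM.
  by apply: bmeas_indic; exact: measurable_elem.
apply: (bmeas_peval (g := id)) => i; apply: bmeas_coord.
  exact: measurable_Omega.
exact: bounded_set_coord.
Qed.

Lemma dgfun_lin t v w x : dgfun (t *: v + w) x = t * dgfun v x + dgfun w x.
Proof.
rewrite /dgfun mulr_sumr -big_split /=; apply: eq_bigr => K _.
by rewrite !ffunE peval_lin mulrDr mulrCA.
Qed.

Lemma dgfun_elem v K x : elem T K x -> dgfun v x = peval (v K) x.
Proof.
move=> Kx; rewrite /dgfun (bigD1 K)//= big1 ?addr0 => [|L LK].
  by rewrite indicE mem_set// mul1r.
rewrite indicE memNset ?mul0r// => Lx.
by have := elem_disjoint LK; apply/eqP/set0P; exists x.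
Qed.

Lemma innerC f g : inner Omega f g = inner Omega g f.
Proof. by apply: eq_Rintegral => x _; rewrite mulrC. Qed.

Lemma inner_dgfun_lin f :
  (lebesgue_rV R d.+1).-integrable Omega (EFin \o f) ->
  scalar (fun v => inner Omega f (dgfun v)).
Proof.
move=> fi t v w /=; rewrite /inner -Rintegral_linear; last 3 first.
- exact: measurable_Omega.
- by apply: integrable_bmeasM => //; [exact: measurable_Omega|exact: bmeas_dgfun].
- by apply: integrable_bmeasM => //; [exact: measurable_Omega|exact: bmeas_dgfun].
by apply: eq_Rintegral => x _; rewrite dgfun_lin mulrDr mulrCA.
Qed.

Lemma bmeas_Omega_integrable f : bmeas Omega f ->
  (lebesgue_rV R d.+1).-integrable Omega (EFin \o f).
Proof.
by apply: bmeas_integrable; [exact: measurable_Omega|exact: Omega_finite].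
Qed.

(** From (|f| - 1)^2 >= 0 follows |f| <= 1 + f^2, and constants are integrable as Omega has finite
    measure. This makes [u0] integrable against broken polynomials. *)
Lemma square_integrable_integrable (f : 'rV[R]_d.+1 -> R) :
  measurable_fun Omega f ->
  (lebesgue_rV R d.+1).-integrable Omega (EFin \o (fun x => f x ^+ 2)) ->
  (lebesgue_rV R d.+1).-integrable Omega (EFin \o f).
Proof.
move=> mf f2; have mO := measurable_Omega.
have i1 := bmeas_Omega_integrable (bmeas_cst Omega (1 : R)).
apply: (le_integrable mO _ _ (integrableD mO i1 f2)).
  exact/measurable_EFinP.
move=> x _ /=; rewrite lee_fin [leRHS]ger0_norm ?addr_ge0 ?sqr_ge0//.
rewrite -[f x ^+ 2]real_normK ?num_real//.
by have := sqr_ge0 (`|f x| - 1); rewrite sqrrB1; have := normr_ge0 (f x); lra.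
Qed.

(** A nonzero piece is nonzero at some point of its element; by continuity its square stays above
    some [c > 0] on a small cube there, and the integral is at least [c] times the measure of that
    cube. *)
Lemma inner_dgfun_posdef v : v != 0 -> 0 < inner Omega (dgfun v) (dgfun v).
Proof.
move=> v0; have [K vK] : exists K, v K != 0.
  apply: contrapT => H; case/eqP: v0; apply/ffunP => K; rewrite ffunE.
  by apply: contrapT => /eqP ?; apply: H; exists K.
(* Shape regularity supplies a point of the element: the centre of its inner ball. *)
have [x [r [r0 xK _]]] := @elem_shape_regular _ _ _ T K.
have Kx : elem T K x.
  apply: xK => /=; rewrite subrr /enorm /dot big1 ?sqrtr0// => i _.
  by rewrite mxE mul0r.
have [e e0 eK] := open_cube (@elem_open _ _ _ T K) Kx.
have [y /eK Ky py] := peval_neq0_cube x vK e0.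
(* Half of the value at [y] leaves room for the strict inequality that defines an open set. *)
pose c := peval (v K) y ^+ 2 / 2.
have c0 : 0 < c by rewrite divr_gt0// exprn_even_gt0.
have p2c : continuous (fun z => peval (v K) z ^+ 2).
  by move=> z; apply: continuousM; exact: continuous_peval.
have oc : open (elem T K `&` (fun z => peval (v K) z ^+ 2) @^-1` [set t | c < t]).
  apply: openI; first exact: elem_open.
  by apply: open_comp => [z _|]; [exact: p2c|exact: open_gt].
have [|s s0 sU] := open_cube oc (x := y).
  by split=> //=; rewrite /c ltr_pdivrMr// ltr_pMr ?exprn_even_gt0// ltr1n.
have mC := @measurable_cube R _ y s.
apply: (@lt_le_trans _ _
  (\int[lebesgue_rV R d.+1]_(z in Omega) (c * \1_(cube y s) z))).
  rewrite RintegralZl; [|exact: measurable_Omega|]; last first.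
    by apply: bmeas_Omega_integrable; exact: bmeas_indic.
  rewrite mulr_gt0// /Rintegral integral_indic//; last exact: measurable_Omega.
  rewrite setIidl; last by move=> z /sU[/elem_sub].
  have muC := congr1 fine (lebesgue_rV_cube y s0).
  by apply: (eq_ind_r (fun r => 0 < r) _ muC); rewrite exprn_gt0// pmulrn_lgt0.
apply: le_Rintegral.
- exact: measurable_Omega.
- apply: bmeas_Omega_integrable; apply: bmeasM; first exact: bmeas_cst.
  exact: bmeas_indic.
- by apply: bmeas_Omega_integrable; apply: bmeasM; exact: bmeas_dgfun.
move=> z Oz; rewrite -expr2 indicE.
case: (boolP (z \in _)) => [/set_mem /sU[Kz cz]|_].
  by rewrite mulr1 (dgfun_elem _ Kz) ltW.
by rewrite mulr0 sqr_ge0.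
Qed.

Lemma jump_lin e t u v x : jump e (t *: u + v) x = t * jump e u x + jump e v x.
Proof. by rewrite /jump !ffunE !peval_lin; ring. Qed.

Lemma avg_dn_lin e t u v x :
  avg_dn e (t *: u + v) x = t * avg_dn e u x + avg_dn e v x.
Proof. by rewrite /avg_dn !ffunE !pgrad_lin !dotl_lin; ring. Qed.

Lemma face_form_sym e w v : face_form w v e = face_form v w e.
Proof. by apply: eq_Rintegral => y _; ring. Qed.

(** Along the chart the integrand is polynomial in bounded coordinates, hence bounded and measurable
    on a domain of finite measure; integrability makes the integral additive. *)
Lemma face_form_lin e v : is_face (elem T) e -> coord_bounded (fset_of e) ->
  scalar (fun w => face_form w v e).
Proof.
move=> [fo _ fiso _ _] fb t u w /=; rewrite /face_form.
have b0 i : bmeas (fdom e) (fun y => fchart e y 0 i).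
  have := bmeas_fchart fiso fb fo 0 i; by under eq_fun do rewrite addr0.
have bs i := bmeas_fchart fiso fb fo (fshift e) i.
have bj z : bmeas (fdom e) (jump e z \o fchart e).
  by apply: bmeasB; exact: bmeas_peval.
have ba z : bmeas (fdom e) (avg_dn e z \o fchart e).
  apply: bmeasM; last exact: bmeas_cst.
  by apply: bmeasD; apply: bmeas_dot => i; [exact: bmeas_pgrad|exact: bmeas_cst|
    exact: bmeas_pgrad|exact: bmeas_cst].
have bf z : bmeas (fdom e)
    ((fun x => avg_dn e z x * jump e v x + jump e z x * avg_dn e v x) \o fchart e).
  apply: (@bmeasD _ _ _ _ (fun y => avg_dn e z _ * _)).
    exact: (bmeasM (ba z) (bj v)).
  exact: (bmeasM (bj z) (ba v)).
rewrite -(face_int_linear fiso fb fo t (bf u) (bf w)).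
apply: eq_Rintegral => y _; rewrite avg_dn_lin jump_lin; ring.
Qed.

Variables (bc : bdry_cond T) (a : R).

Lemma Aform_sym w v : Aform bc a w v = Aform bc a v w.
Proof.
rewrite /Aform /A0 /Ab; congr (_ + _ + _).
- apply: eq_bigr => K _; apply: eq_Rintegral => x _.
  by rewrite dotC (mulrC (peval (w K) x)).
- by apply: eq_bigr => e _; exact: face_form_sym.
- case: bc => [P|//]; congr (_ * _).
  by apply: eq_bigr => e _; exact: face_form_sym.
Qed.

Lemma Aform_lin v : scalar (fun w => Aform bc a w v).
Proof.
move=> t u w /=; rewrite /Aform /A0.
have Ob := bounded_set_coord Omega_bounded.
have volE K (z : broken T) : (lebesgue_rV R d.+1).-integrable (elem T K)
   (EFin \o (fun x => dot (pgrad (z K) x) (pgrad (v K) x)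
             - a / 2 * (peval (z K) x * peval (v K) x))).
  apply: bmeas_integrable; first exact: measurable_elem.
    by apply: lebesgue_rV_bounded; [exact: measurable_elem|exact: elem_bounded].
  have bi i : bmeas (elem T K) (fun x : 'rV[R]_d.+1 => id x 0 i).
    by apply: bmeas_coord; [exact: measurable_elem|exact: elem_bounded].
  apply: bmeasB.
    by apply: bmeas_dot => i; exact: bmeas_pgrad.
  apply: bmeasM; first exact: bmeas_cst.
  by apply: bmeasM; exact: bmeas_peval.
have vol : \sum_(K : cell T) \int[lebesgue_rV R d.+1]_(x in elem T K)
     (dot (pgrad ((t *: u + w) K) x) (pgrad (v K) x)
      - a / 2 * (peval ((t *: u + w) K) x * peval (v K) x)) =
  t * (\sum_(K : cell T) \int[lebesgue_rV R d.+1]_(x in elem T K)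
     (dot (pgrad (u K) x) (pgrad (v K) x)
      - a / 2 * (peval (u K) x * peval (v K) x))) +
  \sum_(K : cell T) \int[lebesgue_rV R d.+1]_(x in elem T K)
     (dot (pgrad (w K) x) (pgrad (v K) x)
      - a / 2 * (peval (w K) x * peval (v K) x)).
  rewrite mulr_sumr -big_split /=; apply: eq_bigr => K _.
  rewrite -Rintegral_linear; [|exact: measurable_elem|exact: volE|exact: volE].
  apply: eq_Rintegral => x _.
  by rewrite !ffunE peval_lin pgrad_lin dotl_lin; ring.
(* Stated for any finite family of bounded faces, this serves both the interfaces and the boundary
   faces. *)
have faceE (F : finType) (fc : F -> face R d (cell T)) :
    (forall i : F, is_face (elem T) (fc i)) ->
    (forall i : F, coord_bounded (fset_of (fc i))) ->
    \sum_(i : F) face_form (t *: u + w) v (fc i) =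
    t * \sum_(i : F) face_form u v (fc i) + \sum_(i : F) face_form w v (fc i).
  move=> ff fb; rewrite mulr_sumr -big_split /=; apply: eq_bigr => i _.
  exact: face_form_lin.
have bdry : Ab bc (t *: u + w) v = t * Ab bc u v + Ab bc w v.
  rewrite /Ab; case: bc => [P|]; last by rewrite mulr0 addr0.
  rewrite faceE; first by ring.
    exact: bfc_face.
  move=> e; apply: coord_boundedS (coord_bounded_closure Ob).
  exact: subset_trans (@bfc_sub _ _ _ _ P e) (@subDsetl _ _ _).
rewrite vol faceE ?bdry; first by ring.
  exact: ifc_face.
by move=> e; apply: coord_boundedS Ob; exact: ifc_sub.
Qed.

End dg_forms.

(** * The monomial basis of V_h *)

Section Vh_basis.
Variables (R : realType) (d : nat) (Omega : set 'rV[R]_d.+1) (T : mesh Omega).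
Variable k : nat.

(** [bmultinom d.+1 k.+1] is the finite type of monomials of degree less than k + 1, that is at most
    k; each pair indexes one monomial on one element, extended by 0. *)
Definition Vh_index : finType := (cell T * bmultinom d.+1 k.+1)%type.

Definition Vh_basis (i : 'I_#|Vh_index|) : broken T :=
  [ffun K => if K == (enum_val i).1 then mpolyX R (enum_val i).2 else 0].

Lemma Vh_basis_sum (c : 'I_#|Vh_index| -> R) K :
  (\sum_i c i *: Vh_basis i) K =
  \sum_(m : bmultinom d.+1 k.+1) c (enum_rank ((K, m) : Vh_index)) *: mpolyX R m.
Proof.
rewrite sum_ffunE (reindex (@enum_rank Vh_index)); last first.
  exact/onW_bij/enum_rank_bij.
pose G L (m : bmultinom d.+1 k.+1) :=
  c (enum_rank ((L, m) : Vh_index)) *: (if K == L then mpolyX R m else 0).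
transitivity (\sum_L \sum_m G L m).
  rewrite pair_bigA /=; apply: eq_bigr => -[L m] _.
  by rewrite !ffunE enum_rankK.
rewrite /G.
rewrite (bigD1 K)//= [X in _ + X]big1 ?addr0 => [|L LK].
  by apply: eq_bigr => m _; rewrite eqxx.
by rewrite big1// => m _; rewrite eq_sym (negbTE LK) scaler0.
Qed.

Lemma Vh_span (v : broken T) :
  Vh k v <-> exists c : 'I_#|Vh_index| -> R, v = \sum_i c i *: Vh_basis i.
Proof.
split=> [vk|[c ->] K].
  exists (fun i : 'I_#|Vh_index| => mcoeff (enum_val i).2 (v (enum_val i).1)).
  apply/ffunP => K; rewrite Vh_basis_sum {1}(mpolywE (vk K)).
  by apply: eq_bigr => m _; rewrite enum_rankK.
rewrite Vh_basis_sum (leq_trans (mmeasure_sum _ _ _ _))//.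
apply/bigmax_leqP => m _; rewrite (leq_trans (mmeasureZ_le _ _ _))//.
by rewrite msizeX bmdeg.
Qed.

Lemma Vh_basis_free (c : 'I_#|Vh_index| -> R) :
  \sum_i c i *: Vh_basis i = 0 -> forall i, c i = 0.
Proof.
move=> c0 i; have := Vh_basis_sum c (enum_val i).1; rewrite c0 ffunE.
move=> /(congr1 (mcoeff (enum_val i).2)); rewrite mcoeff0 raddf_sum /=.
rewrite (bigD1 (enum_val i).2)//= big1 ?addr0 => [|m mi].
  by rewrite mcoeffZ mcoeffX eqxx mulr1 -surjective_pairing enum_valK.
by rewrite mcoeffZ mcoeffX -bmeqP (negbTE mi) mulr0.
Qed.

End Vh_basis.

(** * Back to the two schemes *)

Section theorem_reduction.
Variables (R : realType) (d : nat) (Omega : set 'rV[R]_d.+1) (T : mesh Omega).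
Hypothesis Omega_open : open Omega.
Hypothesis Omega_bounded : bounded_set Omega.
Variables (bc : bdry_cond T) (k : nat) (a : R) (Phi : R -> R).
Hypothesis Phi'_continuous : continuous (derive1 Phi).
Variable u0 : 'rV[R]_d.+1 -> R.
Hypothesis u0_measurable : measurable_fun Omega u0.
Hypothesis u0_L2 : (lebesgue_rV R d.+1).-integrable Omega
  (EFin \o (fun x => u0 x ^+ 2)).
Variables (B dt : R).
Hypothesis dt_gt0 : 0 < dt.
Local Notation ip := (fun v w : broken T => inner Omega (dgfun v) (dgfun w)).
Local Notation beta :=
  (fun w v : broken T => inner Omega (bSAV Omega Phi B (dgfun w)) (dgfun v)).

(** Both schemes are instances, with their own extrapolation [ext] and weight [theta]. *)
Definition sav_scheme (ext : broken T -> broken T -> broken T) (theta : R)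
    (s : sol T) : Prop :=
  sav_seq (Vh k) ip (Aform bc a) beta (fun v => inner Omega u0 (dgfun v))
    (Num.sqrt (potential Omega Phi B u0)) ext theta dt (su s) (sq s) (sr s).

(** Broken polynomials are bounded on Omega and Phi' is continuous, so b(w), whose denominator is a
    constant, is bounded and measurable. *)
Lemma beta_lin w : scalar (beta w).
Proof.
apply: inner_dgfun_lin => //; apply: bmeas_Omega_integrable => //.
apply: bmeasM; last exact: bmeas_cst.
by apply: bmeas_comp => //; exact: bmeas_dgfun.
Qed.

Lemma ip_lin v : scalar (ip^~ v).
Proof.
move=> t u w; rewrite /= !(innerC _ _ (dgfun v)).
apply: inner_dgfun_lin => //; apply: bmeas_Omega_integrable => //.
exact: bmeas_dgfun.
Qed.

Lemma inner_sqr_ge0 f : 0 <= inner Omega f f.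
Proof. by apply: Rintegral_ge0 => x _; rewrite -expr2 sqr_ge0. Qed.

Lemma sav_scheme_exists_unique ext theta : 0 <= theta ->
  exists! s, sav_scheme ext theta s.
Proof.
move=> theta0.
have u0_lin : scalar (fun v : broken T => inner Omega u0 (dgfun v)).
  by apply: inner_dgfun_lin => //; exact: square_integrable_integrable.
have Vs := @Vh_span R d Omega T k; have Vf := @Vh_basis_free R d Omega T k.
have ipC (v w : broken T) : ip v w = ip w v by exact: innerC.
have ip_pos (v : broken T) : Vh k v -> v != 0 -> 0 < ip v v.
  by move=> _; exact: inner_dgfun_posdef.
have A_lin := Aform_lin Omega_bounded bc a.
have A_sym := Aform_sym bc a.
have [u [q [r sP]]] := sav_seq_exists Vs Vf
  (Num.sqrt (potential Omega Phi B u0)) ip_lin ipC ip_pos A_lin A_sym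
  beta_lin u0_lin ext theta0 dt_gt0.
exists (Sol u q r); split=> // -[u' q' r'] s'P.
have H := sav_seq_unique Vs Vf ip_lin ipC ip_pos A_lin A_sym
  beta_lin u0_lin theta0 dt_gt0 sP s'P.
by congr Sol; apply/funext => n; have [] := H n.
Qed.

Lemma energyE (q : broken T) r :
  energy q r = 2^-1 * inner Omega (dgfun q) (dgfun q) + r ^+ 2.
Proof.
by congr (_ * _ + _); apply: eq_Rintegral => x _; rewrite expr2.
Qed.

Lemma L2norm_sqr f : L2norm Omega f ^+ 2 = inner Omega f f.
Proof. by rewrite sqr_sqrtr ?inner_sqr_ge0. Qed.

Lemma sav_scheme_energy ext theta s n : sav_scheme ext theta s ->
  energy_at s n.+1 = energy_at s n
    - L2norm Omega (dgfun (su s n.+1 - su s n)) ^+ 2 / dt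
    - (2 * theta - 1) *
      (2^-1 * L2norm Omega (dgfun (sq s n.+1 - sq s n)) ^+ 2
       + (sr s n.+1 - sr s n) ^+ 2).
Proof.
have Vs := @Vh_span R d Omega T k.
move=> sP; rewrite /energy_at !energyE !L2norm_sqr.
have A_lin := Aform_lin Omega_bounded bc a.
apply: (sav_seq_energy Vs ip_lin _ A_lin _ beta_lin dt_gt0 n sP).
  by move=> v w; exact: innerC.
exact: Aform_sym.
Qed.

(** With theta = 1 the averages are the new values. *)
Lemma first_order_savE s :
  first_order_sav bc k a Phi B u0 dt s <-> sav_scheme (fun _ u => u) 1 s.
Proof.
have aV (x y : broken T) : avgV 1 x y = y.
  by rewrite /avgV subrr scale0r scale1r add0r.
have aR (x y : R) : avgR 1 x y = y by rewrite /avgR subrr mul0r mul1r add0r.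
split=> [[Vn [[_ ui] ri] evol cst rn]|[[[V0 q0] ui c0 ri] stp]].
  split=> [|n]; first by split=> //; exact: cst.
  split; [by split; [have [] := Vn n.+1|have [] := Vn n.+1]| | |exact: rn].
    by move=> phi /(evol n); rewrite aV aR.
  exact: cst.
split=> [n| |n phi Vphi|n|n].
- by case: n => [//|n]; have [[]] := stp n.
- by [].
- by have [_ /(_ _ Vphi) + _ _] := stp n; rewrite aV aR.
- by case: n => [//|n]; have [] := stp n.
- by have [] := stp n.
Qed.

(** With theta = 1/2 the averages are midpoints, and [ustar u n] is the extrapolation from [u n.-1]
    and [u n]. *)
Lemma second_order_savE s : second_order_sav bc k a Phi B u0 dt s <->
  sav_scheme (fun p u => (3 / 2) *: u - 2^-1 *: p) 2^-1 s.
Proof.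
have half : 1 - 2^-1 = 2^-1 :> R by lra.
have aV (x y : broken T) : avgV 2^-1 x y = 2^-1 *: (x + y).
  by rewrite /avgV half scalerDr.
have aR (x y : R) : avgR 2^-1 x y = (x + y) / 2.
  by rewrite /avgR half -mulrDr mulrC.
split=> [[Vn [[_ ui] ri] evol cst rn]|[[[V0 q0] ui c0 ri] stp]].
  split=> [|n]; first by split=> //; exact: cst.
  split; [by split; [have [] := Vn n.+1|have [] := Vn n.+1]| | |exact: rn].
    by move=> phi /(evol n); rewrite aV aR.
  exact: cst.
split=> [n| |n phi Vphi|n|n].
- by case: n => [//|n]; have [[]] := stp n.
- by [].
- by have [_ /(_ _ Vphi) + _ _] := stp n; rewrite aV aR.
- by case: n => [//|n]; have [] := stp n.
- by have [] := stp n.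
Qed.

End theorem_reduction.

Theorem theorem3p1 (R : realType) (d : nat) (Omega : set 'rV[R]_d.+1)
    (Omega_open : open Omega) (Omega_neq0 : Omega !=set0)
    (Omega_bounded : bounded_set Omega) (Omega_convex : convex_set Omega)
    (T : mesh Omega) (bc : bdry_cond T) (k : nat) (a : R)
    (Phi : R -> R) (Phi_derivable : forall x, derivable Phi x 1)
    (Phi'_continuous : continuous (derive1 Phi))
    (u0 : 'rV[R]_d.+1 -> R) (u0_measurable : measurable_fun Omega u0)
    (u0_L2 : (lebesgue_rV R d.+1).-integrable Omega
               (EFin \o (fun x => u0 x ^+ 2)))
    (Phi_u0 : (lebesgue_rV R d.+1).-integrable Omega (EFin \o (Phi \o u0)))
    (B : R) (B_u0 : 0 < potential Omega Phi B u0)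
    (B_Vh : forall v : broken T, Vh k v -> 0 < potential Omega Phi B (dgfun v))
    (dt : R) (dt_gt0 : 0 < dt) :
  ((exists! s, first_order_sav bc k a Phi B u0 dt s) /\
   (forall s, first_order_sav bc k a Phi B u0 dt s -> forall n,
      energy_at s n.+1 =
      energy_at s n
      - L2norm Omega (dgfun (su s n.+1 - su s n)) ^+ 2 / dt
      - 2^-1 * L2norm Omega (dgfun (sq s n.+1 - sq s n)) ^+ 2
      - `|sr s n.+1 - sr s n| ^+ 2)) /\
  ((exists! s, second_order_sav bc k a Phi B u0 dt s) /\
   (forall s, second_order_sav bc k a Phi B u0 dt s -> forall n,
      energy_at s n.+1 =
      energy_at s n
      - L2norm Omega (dgfun (su s n.+1 - su s n)) ^+ 2 / dt)).
Proof.
have eu := sav_scheme_exists_unique Omega_open Omega_bounded bc k a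
  Phi'_continuous u0_measurable u0_L2 B dt_gt0.
have en := sav_scheme_energy Omega_open Omega_bounded Phi'_continuous dt_gt0.
split; split.
- have [s [sP us]] := eu (fun _ u => u) 1 ler01; exists s.
  by split=> [|s' /first_order_savE]; [exact/first_order_savE|exact: us].
(* Here 2 theta - 1 = 1. *)
- move=> s /first_order_savE /en H n; rewrite H real_normK ?num_real//; ring.
- have h0 : 0 <= 2^-1 :> R by rewrite invr_ge0.
  have [s [sP us]] := eu (fun p u => (3 / 2) *: u - 2^-1 *: p) 2^-1 h0; exists s.
  by split=> [|s' /second_order_savE]; [exact/second_order_savE|exact: us].
(* Here 2 theta - 1 = 0, so the increments of q and r drop out. *)
- by move=> s /second_order_savE /en H n; rewrite H mulfV// subrr mul0r subr0.
Qed.
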